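(* Consider a neural ODE, i.e. a system of ODEs $\dot X_i=f_i(\boldsymbol X)$, $i=1,\dots,n$, with $\boldsymbol X=(X_1,\dots,X_n)$, where each $f_i$ is an unknown real-valued function of the full state vector. Neural ODEs are structurally identifiable (i.e. the functions $f_i$ are structurally identifiable) if and only if the full state vector $\boldsymbol X$ is observable.
   Context: An ODE model has the form $\dot{\boldsymbol X}(t)=\boldsymbol F(\boldsymbol X;\boldsymbol f,\boldsymbol p)$, $\boldsymbol Y(t)=\boldsymbol H(\boldsymbol X(t))$, with state $\boldsymbol X\in\mathbb{R}^n$, observed output $\boldsymbol Y$ consisting of some or all of the state variables, known $\boldsymbol F,\boldsymbol H$, unknown scalar parameters $\boldsymbol p$ (none for a neural ODE), and unknown real-valued functions $\boldsymbol f=(f_1,\dots,f_k)$, where $f_j:\mathcal U_j\to\mathbb{R}$ depends on a subset of the state variables. The full state vector is observable if $\boldsymbol Y=\boldsymbol X$; otherwise at least one state variable is unobserved. Two choices of the unknowns give the same observed outputs if they produce the same output trajectory $\boldsymbol Y(t)$ for every initial condition consistent with prior knowledge of the initial conditions. Here the known initial conditions are $\boldsymbol Y(0)$; initial values (and trajectories) of unobserved states are unknown and may differ between the two choices. Fix a generic choice of the unknowns. An unknown function $f_j$ is globally structurally identifiable (or simply structurally identifiable) if every choice giving the same observed outputs as the fixed choice has the same $j$-th function; locally structurally identifiable if there is $\varepsilon>0$ such that every choice giving the same observed outputs and whose $j$-th function is within sup-distance $<\varepsilon$ (over $\mathcal U_j$) of the fixed one has the same $j$-th function; structurally non-identifiable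 otherwise. Structural identifiability refers to the idealised case of arbitrary amounts of noiseless data. *)

(* Defs.v *)
From HB Require Import structures.
From mathcomp Require Import all_boot all_order all_algebra.
From mathcomp Require Import all_classical all_reals all_analysis.

Set Implicit Arguments.
Unset Strict Implicit.
Unset Printing Implicit Defensive.

Import Order.TTheory GRing.Theory Num.Theory.
Import numFieldTopology.Exports numFieldNormedType.Exports.

Local Open Scope classical_set_scope.
Local Open Scope ring_scope.

(* Conventions.  States are row vectors, and U is the common domain of the
   unknown functions f_0, ..., f_(n-1).  They are represented by total functions,
   of which only the values on U matter. *)

Section NeuralODE.
Context {R : realType} {n : nat}.
Implicit Types (U : set 'rV[R]_n) (S : {set 'I_n}) (T : \bar R).
Implicit Types (f g : 'I_n -> 'rV[R]_n -> R) (X : R -> 'rV[R]_n).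

(* X is only relevant on [0, T[, where T = +oo is allowed.  The derivative is
   two-sided for 0 < t; for f continuous, continuity at 0 yields the equation
   with the right derivative there. *)
Definition solution U f (x0 : 'rV[R]_n) T X : Prop :=
  [/\ (0 < T)%E,
      X 0 = x0,
      X t @[t --> 0^'+] --> x0,
      forall t : R, 0 <= t -> (t%:E < T)%E -> U (X t)
    & forall t : R, 0 < t -> (t%:E < T)%E ->
        forall i : 'I_n, is_derive t 1 (fun s => X s ord0 i) (f i (X t))].

Definition maximal_solution U f (x0 : 'rV[R]_n) T X : Prop :=
  solution U f x0 T X /\
  forall T' X', solution U f x0 T' X' ->
    (forall t : R, 0 <= t -> (t%:E < T)%E -> X' t = X t) -> (T' <= T)%E.

Definition well_posed U f : Prop :=
  forall x0, U x0 ->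
    (exists T X, maximal_solution U f x0 T X) /\
    (forall T X T' X', solution U f x0 T X -> solution U f x0 T' X' ->
       forall t : R, 0 <= t -> (t%:E < T)%E -> (t%:E < T')%E -> X t = X' t).

(* The possible choices of the unknowns: continuous vector fields for which "the
   trajectory with a given initial condition" makes sense.  By Picard-Lindelof this
   includes every locally Lipschitz field. *)
Definition admissible U f : Prop :=
  (forall i : 'I_n, {in U, continuous (f i)}) /\ well_posed U f.

(* The output Y = H(X), made of the state variables with index in S. *)
Definition output S (x : 'rV[R]_n) : 'rV[R]_#|S| :=
  \row_(k < #|S|) x ord0 (enum_val k).

Definition fully_observable S : Prop := S = [set: 'I_n]%SET.

(* The initial state x0' may differ from x0 in its unobserved coordinates; equality
   of output trajectories includes equality of their intervals of existence. *)
Definition outputs_reproduced U S f g : Prop :=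
  forall x0 T X, U x0 -> maximal_solution U f x0 T X ->
    exists x0' X',
      [/\ U x0', output S x0' = output S x0,
          maximal_solution U g x0' T X'
        & forall t : R, 0 <= t -> (t%:E < T)%E ->
            output S (X' t) = output S (X t)].

Definition same_observed_outputs U S f g : Prop :=
  outputs_reproduced U S f g /\ outputs_reproduced U S g f.

Definition structurally_identifiable U S f (i : 'I_n) : Prop :=
  forall g, admissible U g -> same_observed_outputs U S f g ->
    forall x, U x -> g i x = f i x.

Definition sup_dist U (u v : 'rV[R]_n -> R) : \bar R :=
  ereal_sup [set `|u x - v x|%:E | x in U].

Definition close U (e : R) f g : Prop :=
  forall i : 'I_n, (sup_dist U (f i) (g i) < e%:E)%E.

(* P holds on a subset of the admissible choices that is open and dense for the
   sup-distance. *)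
Definition generic U (P : ('I_n -> 'rV[R]_n -> R) -> Prop) : Prop :=
  exists O : set ('I_n -> 'rV[R]_n -> R),
    [/\ forall f, O f -> admissible U f,
        forall f, O f -> exists2 e : R, 0 < e &
          forall g, admissible U g -> close U e f g -> O g,
        forall f (e : R), admissible U f -> 0 < e ->
          exists2 g, O g & close U e f g
      & forall f, O f -> P f].

End NeuralODE.

(* Main.v *)
Require Import Defs.
From HB Require Import structures.
From mathcomp Require Import all_boot all_order all_algebra.
From mathcomp Require Import all_classical all_reals all_analysis.
From mathcomp Require Import ring lra.

(* If every state is observed, two fields with the same outputs have the same
   trajectories, and letting t -> 0 in the equations identifies the fields.

   Otherwise let j be an unobserved index.  A diffeomorphism of U that only moves
   the j-th coordinate conjugates f to a field g with the same outputs.  We use the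
   shear phi(x) = x + h(x) e_j with h small, C^1 and supported in U.  If f k p != 0,
   choose h so that h vanishes at p and its gradient there is a nonzero multiple of
   e_k: then phi fixes p and g j p - f j p is a nonzero multiple of f k p.
   Hence the equivalence holds on the open dense set of the fields that are not
   identically 0 on U (the zero field is a limit of nonzero constant fields). *)

Set Implicit Arguments.
Unset Strict Implicit.
Unset Printing Implicit Defensive.

Import Order.TTheory GRing.Theory Num.Theory.
Import numFieldTopology.Exports numFieldNormedType.Exports.

Local Open Scope classical_set_scope.
Local Open Scope ring_scope.

(** * A compactly supported C^1 spline with explicit estimates *)

Section QuadraticSpline.
Context {R : realType}.
Implicit Types u v : R.

Definition pos_part u : R := Num.max u 0.

Lemma pos_partP u : (u <= 0 /\ pos_part u = 0) \/ (0 <= u /\ pos_part u = u).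
Proof.
by rewrite /pos_part; case: (leP u 0) => h; [left|right; split=> //; exact: ltW].
Qed.

Lemma pos_part_lipschitz u v : `|pos_part v - pos_part u| <= `|v - u|.
Proof.
have h1 := ler_norm (v - u); have h2 := ler_norm (- (v - u)).
rewrite normrN in h2; rewrite ler_norml.
by case: (pos_partP u) => -[hu ->]; case: (pos_partP v) => -[hv ->];
   apply/andP; split; lra.
Qed.

(** Convexity of the square of [pos_part] gives the lower bound; the upper one holds because its
    derivative [2 * pos_part] is 2-Lipschitz. *)
Lemma pos_part_sqr_taylor u v :
  0 <= pos_part v ^+ 2 - pos_part u ^+ 2 - 2 * pos_part u * (v - u)
    <= (v - u) ^+ 2.
Proof.
have := sqr_ge0 (v - u); have := sqr_ge0 u; have := sqr_ge0 v.
by case: (pos_partP u) => -[hu ->]; case: (pos_partP v) => -[hv ->];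
   rewrite !expr2 => *; apply/andP; split; nra.
Qed.

(* The quadratic B-spline with knots 0, 1, 2, 3. *)
Definition spline u : R :=
  pos_part u ^+ 2 - 3 * pos_part (u - 1) ^+ 2 + 3 * pos_part (u - 2) ^+ 2
  - pos_part (u - 3) ^+ 2.

(** The derivative of [spline], tied to it through the estimate [spline_taylor]. *)
Definition dspline u : R :=
  2 * (pos_part u - 3 * pos_part (u - 1) + 3 * pos_part (u - 2)
       - pos_part (u - 3)).

(** The weights 1, -3, 3, -1 form a third difference, which kills quadratic polynomials; hence the
    sum vanishes beyond 3. *)
Lemma spline_support u : spline u != 0 -> 0 < u < 3.
Proof.
rewrite /spline; case: (ltP 0 u) => [u0|u0]; case: (ltP u 3) => [u3|u3] //=;
case: (pos_partP u) => -[? ->]; case: (pos_partP (u - 1)) => -[? ->];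
case: (pos_partP (u - 2)) => -[? ->]; case: (pos_partP (u - 3)) => -[? ->];
move=> h; exfalso; try lra; move/eqP: h; apply;
first [ring | have -> : u = 0 by lra | have -> : u = 3 by lra]; ring.
Qed.

(** 36 is a crude constant, shared with the bounds on the derivative, on its increments and on the
    Taylor remainder. *)
Lemma spline_bound u : `|spline u| <= 36.
Proof.
have [->|/spline_support/andP[h0 h3]] := eqVneq (spline u) 0.
  by rewrite normr0; lra.
rewrite /spline ler_norml.
by case: (pos_partP u) => -[? ->]; case: (pos_partP (u - 1)) => -[? ->];
case: (pos_partP (u - 2)) => -[? ->]; case: (pos_partP (u - 3)) => -[? ->];
apply/andP; split; nra.
Qed.

Lemma dspline_bound u : `|dspline u| <= 36.
Proof.
rewrite /dspline ler_norml.
by case: (pos_partP u) => -[? ->]; case: (pos_partP (u - 1)) => -[? ->];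
case: (pos_partP (u - 2)) => -[? ->]; case: (pos_partP (u - 3)) => -[? ->];
apply/andP; split; lra.
Qed.

Lemma dspline_lipschitz u v : `|dspline v - dspline u| <= 36 * `|v - u|.
Proof.
have H a : `|pos_part (v - a) - pos_part (u - a)| <= `|v - u|.
  by rewrite (le_trans (pos_part_lipschitz _ _))// opprB addrA subrK.
have := H 0; rewrite !subr0; move: (H 1) (H 2) (H 3).
by rewrite /dspline !ler_norml => /andP[? ?] /andP[? ?] /andP[? ?] /andP[? ?];
   apply/andP; split; have := normr_ge0 (v - u); lra.
Qed.

Lemma spline_taylor u v :
  `|spline v - spline u - dspline u * (v - u)| <= 36 * `|v - u| ^+ 2.
Proof.
have H a : 0 <= pos_part (v - a) ^+ 2 - pos_part (u - a) ^+ 2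
                - 2 * pos_part (u - a) * (v - u) <= (v - u) ^+ 2.
  by have := pos_part_sqr_taylor (u - a) (v - a); rewrite opprB addrA subrK.
have := H 0; rewrite !subr0; move: (H 1) (H 2) (H 3).
rewrite real_normK ?num_real// /spline /dspline ler_norml.
have := sqr_ge0 (v - u); set d := (v - u) ^+ 2.
move=> ? /andP[? ?] /andP[? ?] /andP[? ?] /andP[? ?].
by apply/andP; split; lra.
Qed.

(** For increments at most 1 the Taylor estimate gives 36 + 36; for larger ones the bound 36 on both
    values suffices. *)
Lemma spline_lipschitz u v : `|spline v - spline u| <= 72 * `|v - u|.
Proof.
have hT := spline_taylor u v.
have hd : `|dspline u * (v - u)| <= 36 * `|v - u|.
  by rewrite normrM ler_wpM2r// dspline_bound.
have hN := ler_normD (spline v - spline u - dspline u * (v - u))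
  (dspline u * (v - u)).
rewrite subrK in hN.
have hB := ler_normB (spline v) (spline u).
have := spline_bound u; have := spline_bound v; have := normr_ge0 (v - u).
by case: (lerP `|v - u| 1) => h *; nra.
Qed.

(** The bump will be centred at the knot 1, where the value is 1 and the slope is non-zero: a
    product of such factors is 1 there, while [spline - 1] vanishes with a non-zero slope. *)
Lemma spline1 : spline 1 = 1.
Proof.
rewrite /spline; case: (pos_partP 1) => -[? ->]; case: (pos_partP (1 - 1)) => -[? ->];
case: (pos_partP (1 - 2)) => -[? ->]; case: (pos_partP (1 - 3)) => -[? ->]; lra.
Qed.

Lemma dspline1 : dspline 1 = 2.
Proof.
rewrite /dspline; case: (pos_partP 1) => -[? ->]; case: (pos_partP (1 - 1)) => -[? ->];
case: (pos_partP (1 - 2)) => -[? ->]; case: (pos_partP (1 - 3)) => -[? ->]; lra.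
Qed.
End QuadraticSpline.

(** * C^1 functions with Lipschitz gradient, in quantitative form *)

Section C11.
Context {R : realType} {n : nat}.
Implicit Types (x y : 'rV[R]_n) (G H : 'rV[R]_n -> R)
  (D E : 'rV[R]_n -> 'I_n -> R).

Definition l1dist x y : R := \sum_i `|y ord0 i - x ord0 i|.

Lemma l1dist_ge0 x y : 0 <= l1dist x y.
Proof. exact: sumr_ge0. Qed.

Lemma coord_le_l1dist x y i : `|y ord0 i - x ord0 i| <= l1dist x y.
Proof. by rewrite /l1dist (bigD1 i)//= lerDl sumr_ge0. Qed.

Lemma l1dist_eq0 x y : l1dist x y = 0 -> x = y.
Proof.
move=> /eqP; rewrite psumr_eq0// => /allP e; apply/rowP => i.
by have := e i (mem_index_enum i); rewrite normr_eq0 subr_eq0 => /eqP ->.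
Qed.

Definition lin D x y : R := \sum_i D x i * (y ord0 i - x ord0 i).

(** The quadratic Taylor remainder is what makes [D] the gradient of [G]. A single constant serves
    for all the bounds, so that rescaling [G] makes them small at once. *)
Definition c11_bound (C : R) G D : Prop :=
  forall x y,
    [/\ `|G x| <= C, `|G y - G x| <= C * l1dist x y,
        forall i, `|D x i| <= C,
        forall i, `|D y i - D x i| <= C * l1dist x y
      & `|G y - G x - lin D x y| <= C * l1dist x y ^+ 2].

Definition c11 G D : Prop := exists2 C, 0 <= C & c11_bound C G D.

Lemma c11_cst (c : R) : c11 (fun=> c) (fun _ _ => 0).
Proof.
exists `|c| => // x y; have d0 := l1dist_ge0 x y.
have -> : lin (fun _ _ => 0) x y = 0 by rewrite /lin big1// => i _; rewrite mul0r.
split=> [//||//|i|]; rewrite ?subrr ?subr0 ?normr0 ?mulr_ge0//; exact: sqr_ge0.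
Qed.

(** The Leibniz rule. The remainder of the product is the product of the increments plus [G x] and
    [H x] times the remainder of the other factor. The 4 comes from the increment of the gradient, a
    sum of four terms. *)
Lemma c11M G H D E : c11 G D -> c11 H E ->
  c11 (fun x => G x * H x) (fun x i => G x * E x i + H x * D x i).
Proof.
move=> [C C0 hC] [K K0 hK]; have CK0 : 0 <= C * K by exact: mulr_ge0.
exists (4 * (C * K)) => [|x y]; first by rewrite mulr_ge0.
have d0 := l1dist_ge0 x y.
have [Gx G1 Dx D1 G2] := hC x y; have [Gy _ _ _ _] := hC y x.
have [Hx H1 Ex E1 H2] := hK x y; have [Hy _ Ey _ _] := hK y x.
set d := l1dist x y in d0 G1 D1 G2 H1 E1 H2 *.
have CKd : 0 <= C * K * d by exact: mulr_ge0.
have CKdd : 0 <= C * K * d ^+ 2 by rewrite mulr_ge0// sqr_ge0.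
have M (a b u v : R) : `|a| <= u -> `|b| <= v -> `|a * b| <= u * v.
  by move=> ? ?; rewrite normrM ler_pM.
split=> [||i|i|].
- by have := M _ _ _ _ Gx Hx; lra.
- have -> : G y * H y - G x * H x = G y * (H y - H x) + H x * (G y - G x) by ring.
  have := M _ _ _ _ Gy H1; have := M _ _ _ _ Hx G1.
  by have := ler_normD (G y * (H y - H x)) (H x * (G y - G x)); nra.
- have := M _ _ _ _ Gx (Ex i); have := M _ _ _ _ Hx (Dx i).
  by have := ler_normD (G x * E x i) (H x * D x i); nra.
- have -> : G y * E y i + H y * D y i - (G x * E x i + H x * D x i) =
    G y * (E y i - E x i) + E x i * (G y - G x)
    + (H y * (D y i - D x i) + D x i * (H y - H x)) by ring.
  have := M _ _ _ _ Gy (E1 i); have := M _ _ _ _ (Ex i) G1.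
  have := M _ _ _ _ Hy (D1 i); have := M _ _ _ _ (Dx i) H1.
  have := ler_normD (G y * (E y i - E x i) + E x i * (G y - G x))
    (H y * (D y i - D x i) + D x i * (H y - H x)).
  have := ler_normD (G y * (E y i - E x i)) (E x i * (G y - G x)).
  by have := ler_normD (H y * (D y i - D x i)) (D x i * (H y - H x)); nra.
have -> : lin (fun x i => G x * E x i + H x * D x i) x y
    = G x * lin E x y + H x * lin D x y.
  by rewrite /lin !mulr_sumr -big_split/=; apply: eq_bigr => i _; ring.
have -> : G y * H y - G x * H x - (G x * lin E x y + H x * lin D x y) =
  (G y - G x) * (H y - H x) + (G x * (H y - H x - lin E x y)
   + H x * (G y - G x - lin D x y)) by ring.
have := M _ _ _ _ G1 H1; have := M _ _ _ _ Gx H2; have := M _ _ _ _ Hx G2.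
set a := _ * (_ - lin D x y); set b := _ * (_ - lin E x y).
set c := (G y - G x) * (H y - H x) => ha hb hc.
have := ler_normD c (b + a); have := ler_normD b a.
have -> : 4 * (C * K) * d ^+ 2 = 4 * (C * K * d ^+ 2) by ring.
have e1 : C * d * (K * d) = C * K * d ^+ 2 by ring.
have e2 : C * (K * d ^+ 2) = C * K * d ^+ 2 by ring.
have e3 : K * (C * d ^+ 2) = C * K * d ^+ 2 by ring.
rewrite e1 in hc; rewrite e2 in hb; rewrite e3 in ha.
lra.
Qed.

Lemma c11_prod (I : Type) (r : seq I) (G : I -> 'rV[R]_n -> R) :
  (forall i, exists D, c11 (G i) D) -> exists D, c11 (fun x => \prod_(i <- r) G i x) D.
Proof.
move=> hG; elim: r => [|i r [D hD]].
  by exists (fun _ _ => 0); under eq_fun do rewrite big_nil; exact: c11_cst.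
have [E hE] := hG i; eexists.
by under eq_fun do rewrite big_cons; exact: c11M hE hD.
Qed.

Lemma c11_spline (l a : R) (k : 'I_n) :
  c11 (fun x => spline (l * (x ord0 k - a) + 1))
      (fun x i => (i == k)%:R * (l * dspline (l * (x ord0 k - a) + 1))).
Proof.
have l0 : 0 <= `|l| by [].
(* This constant has to dominate 36, 72|l|, 36|l| and 36|l|^2. *)
have C0 : 0 <= 72 * (1 + `|l|) ^+ 2 by rewrite mulr_ge0// sqr_ge0.
have C1 : 36 * `|l| <= 72 * (1 + `|l|) ^+ 2 by rewrite expr2; nra.
have C2 : 36 * `|l| ^+ 2 <= 72 * (1 + `|l|) ^+ 2 by rewrite expr2; nra.
exists (72 * (1 + `|l|) ^+ 2) => // x y.
have d0 := l1dist_ge0 x y; have dk := coord_le_l1dist x y k.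
set d := l1dist x y in d0 dk *.
set u := l * (x ord0 k - a) + 1; set v := l * (y ord0 k - a) + 1.
have vu : v - u = l * (y ord0 k - x ord0 k) by rewrite /u /v; ring.
have nvu : `|v - u| = `|l| * `|y ord0 k - x ord0 k| by rewrite vu normrM.
have nvud : `|v - u| <= `|l| * d by rewrite nvu ler_wpM2l.
have linE : lin (fun x i => (i == k)%:R * (l * dspline (l * (x ord0 k - a) + 1))) x y
   = dspline u * (v - u).
  rewrite /lin (bigD1 k)//= eqxx big1 ?addr0; last first.
    by move=> i /negbTE ->; rewrite !mul0r.
  by rewrite mul1r vu /u; ring.
split=> [||i|i|].
- by rewrite (le_trans (spline_bound _))// expr2; nra.
- rewrite (le_trans (spline_lipschitz _ _))// (@le_trans _ _ (72 * (`|l| * d)))//.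
    by rewrite ler_wpM2l.
  by rewrite mulrA ler_wpM2r// expr2; nra.
- rewrite normrM [X in X * _]ger0_norm// normrM.
  rewrite (@le_trans _ _ (`|l| * 36))//; last by lra.
  rewrite (@le_trans _ _ (`|l| * `|dspline u|))//.
    by case: (i == k); rewrite ?mul1r// mul0r mulr_ge0.
  by rewrite ler_wpM2l// dspline_bound.
- rewrite -mulrBr -mulrBr !normrM [X in X * _]ger0_norm//.
  rewrite (@le_trans _ _ (`|l| * `|dspline v - dspline u|))//.
    by case: (i == k); rewrite ?mul1r// mul0r mulr_ge0.
  rewrite (@le_trans _ _ (`|l| * (36 * (`|l| * d))))//.
    by rewrite ler_wpM2l// (le_trans (dspline_lipschitz _ _))// ler_wpM2l.
  have -> : `|l| * (36 * (`|l| * d)) = 36 * `|l| ^+ 2 * d by ring.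
  by rewrite ler_wpM2r.
- rewrite linE (le_trans (spline_taylor _ _))//.
  rewrite (@le_trans _ _ (36 * (`|l| * d) ^+ 2))//.
    by rewrite ler_wpM2l// lerXn2r// nnegrE mulr_ge0.
  have -> : 36 * (`|l| * d) ^+ 2 = 36 * `|l| ^+ 2 * d ^+ 2 by ring.
  by rewrite ler_wpM2r// sqr_ge0.
Qed.

Lemma c11B_cst G D c : c11 G D -> c11 (fun x => G x - c) D.
Proof.
move=> [C C0 h]; exists (C + `|c|) => [|x y]; first by rewrite addr_ge0.
have [h1 h2 h3 h4 h5] := h x y; have d0 := l1dist_ge0 x y.
have c0 := normr_ge0 c.
have dd0 : 0 <= `|c| * l1dist x y by rewrite mulr_ge0.
have dd1 : 0 <= `|c| * l1dist x y ^+ 2 by rewrite mulr_ge0// sqr_ge0.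
have e : G y - c - (G x - c) = G y - G x by ring.
split=> [||i|i|]; rewrite ?e ?mulrDl.
- by have := ler_normB (G x) c; lra.
- lra.
- by have := h3 i; lra.
- by have := h4 i; lra.
- lra.
Qed.
End C11.

(** The bound 1/2 is the smallness that will make the shear invertible. *)
Lemma c11_scale (R : realType) (n : nat) (G : 'rV[R]_n -> R) D :
  c11 G D -> exists2 e : R, 0 < e &
    c11_bound 2^-1 (fun x => e * G x) (fun x i => e * D x i).
Proof.
(* [C + 1] instead of [C] allows for [C = 0]. *)
move=> [C C0 h]; pose e := (2 * (C + 1))^-1.
have e0 : 0 < e by rewrite invr_gt0; lra.
have eC : e * C <= 2^-1.
  by rewrite /e invfM -mulrA ler_piMr// ler_pdivrMl; lra.
exists e => // x y; have [h1 h2 h3 h4 h5] := h x y.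
have d0 := l1dist_ge0 x y.
have N (a z : R) : 0 <= z -> `|a| <= C * z -> `|e * a| <= 2^-1 * z.
  move=> z0 ha; rewrite normrM gtr0_norm// (le_trans (ler_wpM2l (ltW e0) ha))//.
  by rewrite mulrA ler_wpM2r.
split=> [||i|i|].
- by rewrite -[2^-1]mulr1; apply: N => //; rewrite mulr1.
- by rewrite -mulrBr; exact: N.
- by rewrite -[2^-1]mulr1; apply: N => //; rewrite mulr1.
- by rewrite -mulrBr; exact: N.
have -> : lin (fun x i => e * D x i) x y = e * lin D x y.
  by rewrite /lin mulr_sumr; apply: eq_bigr => i _; rewrite mulrA.
by rewrite -!mulrBr; apply: N => //; exact: sqr_ge0.
Qed.

(** * Limits and difference quotients *)

Lemma is_derive1_cvg (R : realType) (f : R -> R) (t l : R) :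
  is_derive t 1 f l <-> s^-1 * (f (s + t) - f t) @[s --> 0^'] --> l.
Proof.
have E : (fun s : R => s^-1 *: ((f \o shift t) (s *: (1 : R)) - f t))
    = (fun s => s^-1 * (f (s + t) - f t)).
  by apply: funext => s /=; rewrite /GRing.scale/= mulr1.
split=> [[+ <-]|h].
- by rewrite /derivable /derive E.
- by apply: DeriveDef; rewrite /derivable /derive E; [exact: cvgP h|exact: cvg_lim h].
Qed.

Lemma cvg_sumr (R : realType) (I T : Type) (F : set_system T) (r : seq I)
    (P : pred I) (f : I -> T -> R) (a : I -> R) {FF : Filter F} :
  (forall i, P i -> f i @ F --> a i) ->
  \sum_(i <- r | P i) f i x @[x --> F] --> \sum_(i <- r | P i) a i.
Proof. by move=> fa; apply: cvg_big => //; exact: add_continuous. Qed.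

Lemma cvg0_norm_le (R : realType) (T : Type) (F : set_system T) {FF : Filter F}
    (g f : T -> R) :
  (\forall x \near F, `|f x| <= g x) -> g @ F --> 0 -> f @ F --> 0.
Proof.
move=> fg g0; apply: norm_cvg0; apply: (squeeze_cvgr _ (cvg_cst 0) g0).
by apply: filterS fg => x ->; rewrite normr_ge0.
Qed.

Lemma cvg_l1dist (R : realType) (n : nat) (x : 'rV[R]_n) :
  l1dist x y @[y --> x] --> 0.
Proof.
rewrite /l1dist.
rewrite [X in _ --> X](_ : 0 = \sum_(i < n) `|x ord0 i - x ord0 i|); last first.
  by rewrite big1// => i _; rewrite subrr normr0.
apply: (@cvg_sumr _ _ _ _ _ _ _ _ (nbhs_filter x)) => i _.
apply: cvg_norm; apply: cvgB; last exact: cvg_cst.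
exact: coord_continuous.
Qed.

Lemma l1_lipschitz_continuous (R : realType) (n : nat) (F : 'rV[R]_n -> R) (C : R) :
  (forall x y, `|F y - F x| <= C * l1dist x y) -> continuous F.
Proof.
move=> hF x; apply/(@subr_cvg0 _ _ _ _ (nbhs_filter x)).
apply: (@cvg0_norm_le _ _ _ (nbhs_filter x) (fun y => C * l1dist x y)).
  exact: nearW.
by rewrite -[X in _ --> X](mulr0 C); apply: cvgMl_tmp; exact: cvg_l1dist.
Qed.

(** The remainder is at most 4C times the squared increment of [Z], hence of order [s ^+ 2].
    Differentiability is asked of [Z] only: for the inverse shear, [X] is the curve whose derivative
    is sought. *)
Lemma c11_remainder_cvg0 (R : realType) (n : nat) (C : R)
    (h : 'rV[R]_n -> R) D (X Z : R -> 'rV[R]_n) (t : R) (w : 'I_n -> R) :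
  0 <= C -> c11_bound C h D ->
  (forall s, l1dist (X t) (X s) <= 2 * l1dist (Z t) (Z s)) ->
  (forall i, is_derive t 1 (fun s => Z s ord0 i) (w i)) ->
  s^-1 * (h (X (s + t)) - h (X t) - lin D (X t) (X (s + t))) @[s --> 0^'] --> 0.
Proof.
move=> C0 hC XZ dZ.
have q i : s^-1 * (Z (s + t) ord0 i - Z t ord0 i) @[s --> 0^'] --> w i.
  exact/is_derive1_cvg.
have nq : \sum_i `|s^-1 * (Z (s + t) ord0 i - Z t ord0 i)| @[s --> 0^']
    --> \sum_i `|w i|.
  by apply: cvg_sumr => i _; exact: cvg_norm.
have id0 : (fun s : R => `|s|) @ 0^' --> 0.
  rewrite -[X in _ --> X](@normr0 _ R); apply: cvg_norm.
  exact: cvg_within_filter cvg_id.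
have lim0 := cvgM id0 (cvgM nq nq); rewrite mul0r in lim0.
have {}lim0 := lim0 _ _.
(* The squared sum of quotients converges, so the factor |s| sends this bound to 0. *)
apply: (@cvg0_norm_le _ _ _ _ (fun s => (4 * C) * (`|s| *
   ((\sum_i `|s^-1 * (Z (s + t) ord0 i - Z t ord0 i)|) *
    (\sum_i `|s^-1 * (Z (s + t) ord0 i - Z t ord0 i)|))))); last first.
  by rewrite -[X in _ --> X](mulr0 (4 * C)); apply: cvgMl_tmp; exact: lim0.
near=> s; rewrite normrM.
have s0 : s != 0 by near: s; exact: nbhs_dnbhs_neq.
have S0 : 0 < `|s^-1| by rewrite normr_gt0 invr_eq0.
have -> : \sum_i `|s^-1 * (Z (s + t) ord0 i - Z t ord0 i)|
    = `|s^-1| * l1dist (Z t) (Z (s + t)).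
  by rewrite /l1dist mulr_sumr; apply: eq_bigr => i _; rewrite normrM.
have [_ _ _ _ H] := hC (X t) (X (s + t)).
have e0 := l1dist_ge0 (Z t) (Z (s + t)).
have d0 := l1dist_ge0 (X t) (X (s + t)).
have {}XZ := XZ (s + t).
set e := l1dist (Z t) _ in XZ e0 *; set d := l1dist (X t) _ in H d0 XZ *.
have -> : 4 * C * (`|s| * (`|s^-1| * e * (`|s^-1| * e))) =
    (`|s| * `|s^-1|) * (`|s^-1| * (4 * C * (e * e))) by ring.
have -> : `|s| * `|s^-1| = 1 by rewrite -normrM mulfV// normr1.
rewrite mul1r; apply: ler_wpM2l => //.
apply: (le_trans H); have -> : 4 * C * (e * e) = C * (2 * e) ^+ 2 by ring.
by rewrite ler_wpM2l// lerXn2r// nnegrE mulr_ge0.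
Unshelve. all: by end_near. Qed.

(** * The shear along one coordinate and its inverse *)

Section Shear.
Context {R : realType} {n : nat}.
Variables (h : 'rV[R]_n -> R) (D : 'rV[R]_n -> 'I_n -> R) (j : 'I_n).
Hypothesis hD : c11_bound 2^-1 h D.
Implicit Types x y : 'rV[R]_n.

Definition shear x : 'rV[R]_n := x + h x *: delta_mx ord0 j.

Lemma shearE x i : shear x ord0 i = x ord0 i + (i == j)%:R * h x.
Proof. by rewrite !mxE eqxx mulrC. Qed.

(** The shear alters increments by that of [h], at most half the l1 distance, which is absorbed on
    the left. This yields injectivity and a Lipschitz inverse. *)
Lemma shear_expanding x y : l1dist x y <= 2 * l1dist (shear x) (shear y).
Proof.
have [_ H _ _ _] := hD x y.
suff : l1dist x y <= l1dist (shear x) (shear y) + `|h y - h x| by lra.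
have -> : `|h y - h x| = \sum_i (i == j)%:R * `|h y - h x|.
  by rewrite (bigD1 j)//= eqxx mul1r big1 ?addr0// => i /negbTE ->; rewrite mul0r.
rewrite /l1dist -big_split/=; apply: ler_sum => i _; rewrite !shearE.
case: (i == j); rewrite ?mul1r ?mul0r ?addr0//.
have := ler_normB (y ord0 i + h y - (x ord0 i + h x)) (h y - h x).
by congr (`| _ | <= _); ring.
Qed.

Lemma shear_inj : injective shear.
Proof.
move=> x y e; apply: l1dist_eq0; apply/eqP; rewrite eq_le l1dist_ge0 andbT.
apply: (le_trans (shear_expanding x y)).
by rewrite e /l1dist big1 ?mulr0// => i _; rewrite subrr normr0.
Qed.

(** A preimage is sought on the line through [y] along the j-th axis, as a zero of [u + h (l u)]. As
    |h| is at most 1/2, this function changes sign on [-1, 1]. *)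
Lemma shear_surj y : exists x, shear x = y.
Proof.
pose l (u : R) := y + u *: delta_mx ord0 j : 'rV[R]_n.
have hl u v : `|h (l v) - h (l u)| <= 2^-1 * `|v - u|.
  have [_ + _ _ _] := hD (l u) (l v).
  rewrite /l1dist (bigD1 j)//= big1 ?addr0 => [|i ij]; last first.
    by rewrite !mxE (negbTE ij) andbF !mulr0 subrr normr0.
  by rewrite !mxE !eqxx !mulr1 opprD addrACA subrr add0r.
have b u : `|h u| <= 2^-1 by have [] := hD u u.
have cf : continuous (fun u => u + h (l u)).
  move=> u; apply: cvgD; first exact: cvg_id.
  apply/(@subr_cvg0 _ _ _ _ (nbhs_filter u)).
  apply: (@cvg0_norm_le _ _ _ (nbhs_filter u) (fun v => 2^-1 * `|v - u|)).
    by apply: nearW => v; exact: hl.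
  rewrite -[X in _ --> X](mulr0 2^-1); apply: cvgMl_tmp.
  apply/norm_cvg0P/subr_cvg0; exact: cvg_id.
have le11 : (- 1 : R) <= 1 by lra.
have [|u _ u0] := @IVT R (fun u => u + h (l u)) (- 1) 1 0 le11
    (continuous_subspaceT cf).
  have := b (l (- 1)); have := b (l 1).
  rewrite !ler_norml ge_min le_max => /andP[? ?] /andP[? ?].
  by apply/andP; split; apply/orP; [left|right]; lra.
exists (l u); rewrite /shear /l -addrA -scalerDl.
by rewrite -/(l u) u0 scale0r addr0.
Qed.

Definition unshear y : 'rV[R]_n := projT1 (cid (shear_surj y)).

Lemma unshearK : cancel unshear shear.
Proof. by move=> y; rewrite /unshear; case: cid. Qed.

Lemma shearK : cancel shear unshear.
Proof. by move=> x; apply: shear_inj; rewrite unshearK. Qed.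

Lemma shear_continuous : continuous shear.
Proof.
have hc : continuous h.
  by apply: (@l1_lipschitz_continuous _ _ _ 2^-1) => u v; have [] := hD u v.
move=> x; apply: (@cvgD _ _ _ _ (nbhs_filter x)); first exact: cvg_id.
by apply: (@cvgZr_tmp _ _ _ _ (nbhs_filter x)); exact: hc.
Qed.

Lemma unshearE y : unshear y = y - h (unshear y) *: delta_mx ord0 j.
Proof. by apply/eqP; rewrite eq_sym subr_eq -/(shear _) unshearK. Qed.

(** [h \o unshear] is 1-Lipschitz, the factor 1/2 of [h] cancelling the 2 of [shear_expanding]; the
    implicit equation [unshearE] then gives continuity. *)
Lemma unshear_continuous : continuous unshear.
Proof.
have hc : continuous (h \o unshear).
  apply: (@l1_lipschitz_continuous _ _ _ 1) => u v.
  have [_ H _ _ _] := hD (unshear u) (unshear v).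
  have := shear_expanding (unshear u) (unshear v); rewrite !unshearK /=; lra.
rewrite (_ : unshear = fun y => y - h (unshear y) *: delta_mx ord0 j); last first.
  by apply: funext => y; exact: unshearE.
move=> x; apply: (@cvgB _ _ _ _ (nbhs_filter x)); first exact: cvg_id.
by apply: (@cvgZr_tmp _ _ _ _ (nbhs_filter x)); exact: hc.
Qed.

(** The chain rule: the difference quotient of [h \o X] is that of the Taylor remainder, which
    vanishes in the limit, plus the gradient applied to the quotients of the coordinates. *)
Lemma shear_derive (X : R -> 'rV[R]_n) (t : R) (w : 'I_n -> R) :
  (forall i, is_derive t 1 (fun s => X s ord0 i) (w i)) ->
  forall i, is_derive t 1 (fun s => shear (X s) ord0 i)
    (w i + (i == j)%:R * \sum_k D (X t) k * w k).
Proof.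
move=> dX i; apply/is_derive1_cvg.
have q k : s^-1 * (X (s + t) ord0 k - X t ord0 k) @[s --> 0^'] --> w k.
  exact/is_derive1_cvg.
have rem := c11_remainder_cvg0 (X := X) (Z := X) _ hD _ dX.
have {}rem : s^-1 * (h (X (s + t)) - h (X t) - lin D (X t) (X (s + t)))
   @[s --> 0^'] --> 0.
  by apply: rem => // s; have := l1dist_ge0 (X t) (X s); lra.
have qs : \sum_k D (X t) k * (s^-1 * (X (s + t) ord0 k - X t ord0 k))
    @[s --> 0^'] --> \sum_k D (X t) k * w k.
  by apply: cvg_sumr => k _; exact: cvgMl_tmp.
have := cvgD (q i) (cvgMl_tmp (a := (i == j)%:R) (cvgD rem qs)) => /(_ _ _ _).
rewrite add0r; apply: cvg_trans; apply: near_eq_cvg; apply: nearW => s.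
rewrite !shearE !fctE /=.
have -> : \sum_k D (X t) k * (s^-1 * (X (s + t) ord0 k - X t ord0 k))
  = s^-1 * lin D (X t) (X (s + t)).
  by rewrite /lin mulr_sumr; apply: eq_bigr => k _; ring.
ring.
Qed.

(* [unshear] is only known to be Lipschitz a priori; the Taylor expansion of [h]
   along [unshear \o Y], divided by the increment of time, is solved for the
   difference quotient of the j-th coordinate, using [1 + D x j != 0]. *)
Lemma unshear_derive (Y : R -> 'rV[R]_n) (t : R) (w : 'I_n -> R) :
  (forall i, is_derive t 1 (fun s => Y s ord0 i)
     (w i + (i == j)%:R * \sum_k D (unshear (Y t)) k * w k)) ->
  forall i, is_derive t 1 (fun s => unshear (Y s) ord0 i) (w i).
Proof.
move=> dY; pose X s := unshear (Y s).
have YX s i : Y s ord0 i = X s ord0 i + (i == j)%:R * h (X s).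
  by rewrite -shearE unshearK.
have q k : s^-1 * (Y (s + t) ord0 k - Y t ord0 k) @[s --> 0^'] -->
    w k + (k == j)%:R * \sum_k D (unshear (Y t)) k * w k.
  exact/is_derive1_cvg.
have qn k : k != j -> s^-1 * (X (s + t) ord0 k - X t ord0 k) @[s --> 0^'] --> w k.
  move=> kj; have := q k; rewrite (negbTE kj) mul0r addr0.
  by under eq_fun do rewrite !YX (negbTE kj) !mul0r !addr0.
move=> i; have [->|ij] := eqVneq i j; last exact/is_derive1_cvg/qn.
apply/is_derive1_cvg.
have rem : s^-1 * (h (X (s + t)) - h (X t) - lin D (X t) (X (s + t)))
   @[s --> 0^'] --> 0.
  apply: (c11_remainder_cvg0 _ hD _ dY) => // s.
  by have := shear_expanding (X t) (X s); rewrite !unshearK.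
have qs : \sum_(k < n | k != j) D (X t) k * (s^-1 * (X (s + t) ord0 k - X t ord0 k))
    @[s --> 0^'] --> \sum_(k < n | k != j) D (X t) k * w k.
  by apply: cvg_sumr => k kj; apply: cvgMl_tmp; exact: qn.
(* The gradient is bounded by 1/2, so this coefficient is at least 1/2. *)
have Dj : 1 + D (X t) j != 0.
  have [_ _ + _ _] := hD (X t) (X t); move=> /(_ j); rewrite ler_norml => /andP[? ?].
  by rewrite gt_eqF//; lra.
have := cvgMl_tmp (a := (1 + D (X t) j)^-1) (cvgB (cvgB (q j) rem) qs) => /(_ _ _ _).
rewrite eqxx mul1r subr0 [X in w j + X](bigD1 j)//= addrA addrK.
rewrite -{1}[w j]mul1r -mulrDl mulKf//.
apply: cvg_trans; apply: near_eq_cvg; apply: nearW => s.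
rewrite !fctE /= !YX eqxx !mul1r.
have -> : lin D (X t) (X (s + t)) = D (X t) j * (X (s + t) ord0 j - X t ord0 j)
  + \sum_(k < n | k != j) D (X t) k * (X (s + t) ord0 k - X t ord0 k).
  by rewrite /lin (bigD1 j).
have -> : \sum_(k < n | k != j) D (X t) k * (s^-1 * (X (s + t) ord0 k - X t ord0 k))
  = s^-1 * \sum_(k < n | k != j) D (X t) k * (X (s + t) ord0 k - X t ord0 k).
  by rewrite mulr_sumr; apply: eq_bigr => k _; ring.
by move: (s^-1) => r; field.
Qed.

End Shear.

(** * Transport of solutions by a conjugation *)

Section Conjugation.
Context {R : realType} {n : nat}.
Variables (U : set 'rV[R]_n) (f g : 'I_n -> 'rV[R]_n -> R).
Variables (phi psi : 'rV[R]_n -> 'rV[R]_n).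
Hypotheses (phiK : cancel phi psi) (psiK : cancel psi phi).
Hypotheses (phiU : forall x, U x -> U (phi x)) (psiU : forall x, U x -> U (psi x)).
Hypothesis phi_sol : forall x0 T X,
  solution U f x0 T X -> solution U g (phi x0) T (phi \o X).
Hypothesis psi_sol : forall x0 T X,
  solution U g x0 T X -> solution U f (psi x0) T (psi \o X).

(** An extension of [phi \o X] pulls back by [psi] to an extension of [X], so the maximal time is
    preserved. *)
Lemma conj_maximal_solution x0 T X :
  maximal_solution U f x0 T X -> maximal_solution U g (phi x0) T (phi \o X).
Proof.
move=> [sX mX]; split; first exact: phi_sol.
move=> T' X' sX' eX'; apply: (mX T' (psi \o X')).
  by rewrite -[x0]phiK; exact: psi_sol.
by move=> t t0 tT /=; rewrite eX'//= phiK.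
Qed.

Lemma conj_well_posed : well_posed U f -> well_posed U g.
Proof.
move=> wf x0 Ux0; have [[T [X mX]] u] := wf _ (psiU Ux0); split.
  by exists T, (phi \o X); rewrite -[x0]psiK; exact: conj_maximal_solution.
move=> T1 X1 T2 X2 /psi_sol s1 /psi_sol s2 t t0 t1 t2.
by apply: (can_inj psiK); exact: (u _ _ _ _ s1 s2 t).
Qed.

Lemma conj_outputs_reproduced (S : {set 'I_n}) :
  (forall x, output S (phi x) = output S x) -> outputs_reproduced U S f g.
Proof.
move=> oS x0 T X Ux0 mX; exists (phi x0), (phi \o X); split.
- exact: phiU.
- exact: oS.
- exact: conj_maximal_solution.
- by move=> t _ _; exact: oS.
Qed.
End Conjugation.

(** * A small bump with prescribed gradient direction at a point *)

Lemma exists_bump (R : realType) (n : nat) (U : set 'rV[R]_n) (p : 'rV[R]_n)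
    (k : 'I_n) : open U -> U p ->
  exists h D, [/\ c11_bound 2^-1 h D, forall x, h x != 0 -> U x, h p = 0,
    D p k != 0 & forall i, i != k -> D p i = 0].
Proof.
move=> oU Up; have /nbhs_ballP[r /= r0 rU] : nbhs p U by exact: open_nbhs_nbhs.
(* The i-th factor is non-zero only where -1 < l (x_i - p_i) < 2, hence |x_i - p_i| < 2 / l = r: the
   product vanishes off the ball of radius [r]. *)
pose l := 2 / r; have l0 : 0 < l by rewrite divr_gt0.
pose b i (x : 'rV[R]_n) := spline (l * (x ord0 i - p ord0 i) + 1).
have [E hE] : exists E, c11 (fun x => \prod_i b i x) E.
  by apply: c11_prod => i; eexists; exact: c11_spline.
have hk := c11B_cst 1 (c11_spline l (p ord0 k) k).
have [e e0 he] := c11_scale (c11M hE hk).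
have lp i : l * (p ord0 i - p ord0 i) + 1 = 1 by rewrite subrr mulr0 add0r.
have bp : \prod_i b i p = 1 by rewrite big1// => i _; rewrite /b lp spline1.
(* The perturbation is e * B * (b k - 1) with B the product of the b i: it vanishes
   at p since b k p = 1, with gradient there a multiple of the k-th unit vector. *)
eexists _, _; split; first exact: he.
- move=> x; rewrite !mulf_eq0 !negb_or => /and3P[_ /prodf_neq0 bx _].
  apply: rU; split=> // i0 i; rewrite (ord1 i0) /ball/=.
  have /spline_support/andP[h1 h2] := bx i isT.
  have h3 : - 1 < l * (x ord0 i - p ord0 i) by lra.
  have h4 : l * (x ord0 i - p ord0 i) < 2 by lra.
  have : l * `|p ord0 i - x ord0 i| < 2.
    by rewrite -{1}(gtr0_norm l0) -normrM ltr_norml; apply/andP; split; lra.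
  by rewrite -ltr_pdivlMl// /l invf_div divfK// ?gt_eqF.
- by rewrite /= lp spline1 subrr !mulr0.
- rewrite /= bp lp spline1 dspline1 subrr mul0r addr0 eqxx !mul1r.
  by rewrite gt_eqF//; exact: mulr_gt0 e0 (mulr_gt0 l0 (ltr0Sn _ 1)).
- by move=> i /negbTE ik; rewrite lp spline1 subrr !mul0r ik !(mul0r, mulr0, addr0).
Qed.

(** * Push-forward of a field by a shear supported in [U] *)

Section ShearConjugate.
Context {R : realType} {n : nat}.
Variables (U : set 'rV[R]_n) (f : 'I_n -> 'rV[R]_n -> R).
Variables (h : 'rV[R]_n -> R) (D : 'rV[R]_n -> 'I_n -> R) (j : 'I_n).
Hypotheses (hD : c11_bound 2^-1 h D) (hU : forall x, h x != 0 -> U x).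

Local Notation phi := (shear h j).
Local Notation psi := (unshear j hD).

Lemma shear_out x : ~ U x -> phi x = x.
Proof.
move=> nUx; rewrite /shear; have [->|/hU//] := eqVneq (h x) 0.
by rewrite scale0r addr0.
Qed.

(** Points outside [U] are fixed. Were [phi x] outside, [phi (phi x) = phi x] and injectivity would
    give [phi x = x], a point of [U]. *)
Lemma shear_dom x : U x -> U (phi x).
Proof.
move=> Ux; apply: contrapT => nU.
have /(shear_inj hD) e := shear_out nU.
by rewrite e in nU.
Qed.

Lemma unshear_dom y : U y -> U (psi y).
Proof.
move=> Uy; apply: contrapT => nU; have := shear_out nU; rewrite unshearK => e.
by rewrite -e in nU.
Qed.

(* The push-forward of the vector field f by the shear. *)
Definition shear_conj (i : 'I_n) (y : 'rV[R]_n) : R :=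
  f i (psi y) + (i == j)%:R * \sum_k D (psi y) k * f k (psi y).

Lemma shear_solution x0 T X :
  solution U f x0 T X -> solution U shear_conj (phi x0) T (phi \o X).
Proof.
move=> [T0 X0 cX UX dX]; split=> //.
- by rewrite /= X0.
- by apply: continuous_cvg cX; exact: (shear_continuous hD).
- by move=> t t0 tT; exact/shear_dom/UX.
- move=> t t0 tT i; rewrite /shear_conj /= shearK.
  exact: (shear_derive j hD (w := fun i => f i (X t)) (dX t t0 tT)).
Qed.

Lemma unshear_solution y0 T Y :
  solution U shear_conj y0 T Y -> solution U f (psi y0) T (psi \o Y).
Proof.
move=> [T0 Y0 cY UY dY]; split=> //.
- by rewrite /= Y0.
- by apply: continuous_cvg cY; exact: unshear_continuous.
- by move=> t t0 tT; exact/unshear_dom/UY.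
- move=> t t0 tT.
  exact: (unshear_derive (w := fun i => f i (psi (Y t))) (dY t t0 tT)).
Qed.

(** Well-posedness is carried over by the conjugation of solutions: [f] is only known to be
    continuous, so regularity of the new field could not provide it. *)
Lemma shear_conj_admissible : admissible U f -> admissible U shear_conj.
Proof.
move=> [cf wf]; split; last first.
  exact: (conj_well_posed (@shearK _ _ _ _ _ _) (@unshearK _ _ _ _ _ _) unshear_dom
    shear_solution unshear_solution wf).
move=> i y /[!inE] Uy.
have cfp k : (f k \o psi) z @[z --> y] --> f k (psi y).
  have pU : psi y \in U by rewrite inE; exact: unshear_dom.
  apply: (@continuous_cvg _ _ _ _ (nbhs_filter y) psi (f k) (psi y)).
    exact: cf pU.
  exact: unshear_continuous.
have cDp k : D (psi z) k @[z --> y] --> D (psi y) k.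
  apply: (@continuous_cvg _ _ _ _ (nbhs_filter y) psi (D ^~ k) (psi y));
    last exact: unshear_continuous.
  apply: (@l1_lipschitz_continuous _ _ _ 2^-1) => u v.
  by have [_ _ _ + _] := hD u v.
apply: (@cvgD _ _ _ _ (nbhs_filter y)); first exact: cfp.
apply: (@cvgMl_tmp _ _ _ (nbhs_filter y)).
apply: (@cvg_sumr _ _ _ _ _ _ _ _ (nbhs_filter y)) => k _.
by apply: (@cvgM _ _ _ (nbhs_filter y)); [exact: cDp|exact: cfp].
Qed.

Lemma shear_conj_same_outputs (S : {set 'I_n}) :
  j \notin S -> same_observed_outputs U S f shear_conj.
Proof.
move=> jS; have oS x : output S (phi x) = output S x.
  apply/rowP => k; rewrite !mxE eqxx/=.
  have /negbTE -> : enum_val k != j.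
    by apply: contraNneq jS => <-; exact: enum_valP.
  by rewrite mulr0 addr0.
split.
- exact: (conj_outputs_reproduced (@shearK _ _ _ _ _ _) shear_dom
    shear_solution unshear_solution oS).
- apply: (conj_outputs_reproduced (@unshearK _ _ _ _ _ _) unshear_dom
    unshear_solution shear_solution) => x.
  by rewrite -oS unshearK.
Qed.

End ShearConjugate.

Lemma unobserved_not_identifiable (R : realType) (n : nat) (U : set 'rV[R]_n)
    (S : {set 'I_n}) (f : 'I_n -> 'rV[R]_n -> R) (j k : 'I_n) (p : 'rV[R]_n) :
  open U -> admissible U f -> j \notin S -> U p -> f k p != 0 ->
  ~ structurally_identifiable U S f j.
Proof.
move=> oU af jS Up fp.
have [h [D [hD hU hp Dk Di]]] := exists_bump k oU Up.
move=> /(_ _ (shear_conj_admissible j hD hU af)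
  (shear_conj_same_outputs f hD hU jS) p Up).
have sp : shear h j p = p by rewrite /shear hp scale0r addr0.
have ep : unshear j hD p = p by rewrite -{1}sp shearK.
(* At the fixed point [p] the j-th components differ by the single surviving term
   [D p k * f k p]. *)
rewrite /shear_conj ep eqxx mul1r (bigD1 k)//= big1 => [|i /Di ->]; last first.
  by rewrite mul0r.
rewrite addr0 => /eqP; rewrite -subr_eq0 addrAC subrr add0r mulf_eq0.
by rewrite (negbTE Dk) (negbTE fp).
Qed.

(** * Constant fields and their maximal solutions *)

Lemma affine_derive (R : realType) (a c t : R) : is_derive t 1 (fun s => a + s * c) c.
Proof.
apply/is_derive1_cvg; apply: (@cvg_trans _ (c @[s --> (0 : R)^'])); last exact: cvg_cst.
apply: near_eq_cvg; near=> s.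
have s0 : s != 0 by near: s; exact: nbhs_dnbhs_neq.
by field.
Unshelve. all: by end_near. Qed.

Section ConstantField.
Context {R : realType} {n : nat}.
Variables (U : set 'rV[R]_n) (c : R).
Local Notation ray x0 := (fun t : R => x0 + t *: const_mx c : 'rV[R]_n).
Local Notation cst_field := (fun (_ : 'I_n) (_ : 'rV[R]_n) => c).

Lemma ray_continuous x0 : continuous (ray x0).
Proof.
move=> t; apply: cvgD; first exact: cvg_cst.
by apply: cvgZr_tmp; exact: cvg_id.
Qed.

Lemma ray_solution (x0 : 'rV[R]_n) T : (0 < T)%E ->
  (forall t, 0 <= t -> (t%:E < T)%E -> U (x0 + t *: const_mx c)) ->
  solution U cst_field x0 T (ray x0).
Proof.
move=> T0 rU; split=> //.
- by rewrite scale0r addr0.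
- rewrite -[X in _ --> X](addr0 x0) -[X in _ --> x0 + X](scale0r (const_mx c)).
  exact: (cvg_at_right_filter (@ray_continuous x0 0)).
- move=> t _ _ i; under eq_fun do rewrite !mxE; exact: affine_derive.
Qed.

(** The mean value theorem is applied to each coordinate on [0, t]; at the endpoint 0 the right
    continuity of a solution suffices. *)
Lemma field_solution_ray x0 T X : solution U cst_field x0 T X ->
  forall t, 0 <= t -> (t%:E < T)%E -> X t = x0 + t *: const_mx c.
Proof.
move=> [T0 X0 cX UX dX] t; rewrite le_eqVlt => /predU1P[<- _|t0 tT].
  by rewrite X0 scale0r addr0.
apply/rowP => i; rewrite !mxE.
have d s : s \in `]0, t[ -> is_derive s 1 (fun s => X s ord0 i) c.
  rewrite in_itv/= => /andP[s0 st]; apply: dX => //.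
  by apply: lt_trans tT; rewrite lte_fin.
have [|z _] := MVT t0 d.
  apply/continuous_within_itvP => //; split.
  - move=> s /d ds; apply: differentiable_continuous; exact/derivable1_diffP.
  - rewrite X0; apply: (@continuous_cvg _ _ _ _ _ X (fun M => M ord0 i) x0 _ cX).
    exact: coord_continuous.
  - apply: cvg_at_left_filter; apply: differentiable_continuous.
    by apply/derivable1_diffP; have := dX t t0 tT i.
by rewrite subr0 X0 mulrC => /eqP; rewrite subr_eq addrC => /eqP.
Qed.

Lemma cst_admissible : open U -> admissible U cst_field.
Proof.
move=> oU; split; first by move=> i x _; exact: cst_continuous.
move=> x0 Ux0; split; last first.
  move=> T X T' X' sX sX' t t0 tT tT'.
  by rewrite (field_solution_ray sX)// (field_solution_ray sX').
(* Every solution is a restriction of the ray, so the maximal time is the supremum of the times up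
   to which the ray is a solution; openness of [U] provides a positive one. *)
pose A := [set T | solution U cst_field x0 T (ray x0)].
have [T1 AT1] : exists T1, A T1.
  have /nbhs_ballP[e /= e0 eU] : nbhs (0 : R) (ray x0 @^-1` U).
    by apply: ray_continuous; rewrite scale0r addr0; exact: open_nbhs_nbhs.
  exists e%:E; apply: ray_solution; first by rewrite lte_fin.
  move=> t t0; rewrite lte_fin => te; apply: eU.
  by rewrite /ball/= sub0r normrN ger0_norm.
exists (ereal_sup A), (ray x0); split.
  apply: ray_solution.
    by apply: (@lt_le_trans _ _ T1); [case: AT1|exact: ereal_sup_ubound].
  move=> t t0 /ereal_sup_gt[T [_ _ _ UX _]] tT; exact: UX.
move=> T' X' sX' _; apply: ereal_sup_ubound.
have [T0 _ _ UX' _] := sX'; apply: ray_solution => // t t0 tT.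
by rewrite -(field_solution_ray sX')//; exact: UX'.
Qed.

End ConstantField.

(** * Identifiability when every state is observed *)

Lemma fully_observable_identifiable (R : realType) (n : nat) (U : set 'rV[R]_n)
    (S : {set 'I_n}) (f : 'I_n -> 'rV[R]_n -> R) (i : 'I_n) :
  admissible U f -> fully_observable S -> structurally_identifiable U S f i.
Proof.
move=> [cf wf] -> g [cg wg] [fg _] x Ux.
have oI (y z : 'rV[R]_n) : output [set: 'I_n]%SET y = output [set: 'I_n]%SET z -> y = z.
  move=> e; apply/rowP => k.
  have := congr1 (fun M : 'rV_ _ => M ord0 (enum_rank_in (finset.in_setT k) k)) e.
  by rewrite !mxE enum_rankK_in ?finset.in_setT.
have [[T [X mX]] _] := wf x Ux.
have [x' [X' [_ /oI ex [sX' _] eX]]] := fg x T X Ux mX; subst x'.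
have [[T0 X0 cX UX dX] _] := mX; have [_ X'0 cX' UX' dX'] := sX'.
have gt0 : \forall t \near (0:R)^'+, (0 < t) && (t%:E < T)%E.
  have [e e0 eT] : exists2 e : R, 0 < e & (e%:E <= T)%E.
    case: T T0 {mX sX' eX UX dX UX' dX'} => [r|_|//].
      by rewrite lte_fin => r0; exists r.
    by exists 1 => //; rewrite leey.
  near=> t; apply/andP; split; first by near: t; exact: nbhs_right_gt.
  by apply: lt_le_trans eT; rewrite lte_fin; near: t; exact: nbhs_right_lt.
have lim (h : 'I_n -> 'rV[R]_n -> R) :
    {in U, continuous (h i)} -> h i (X t) @[t --> 0^'+] --> h i x.
  move=> ch; apply: (@continuous_cvg _ _ _ _ _ X (h i) x _ cX).
  by apply: ch; rewrite inE.
have lf := lim f (cf i); have lg := lim g (cg i).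
(* The equations are given for t > 0 only, so the fields are compared along the common trajectory
   and the limit at 0 is taken. *)
apply/esym; refine (cvg_unique (@norm_hausdorff _ R) lf _).
apply: cvg_trans lg; apply: near_eq_cvg; near=> t.
have /andP[t0 tT] : (0 < t) && (t%:E < T)%E by near: t.
have XX' s : 0 <= s -> (s%:E < T)%E -> X' s = X s.
  by move=> s0 sT; apply: oI; exact: eX.
have dg := dX' t t0 tT i; have df := dX t t0 tT i.
rewrite XX' ?(ltW t0)// in dg.
rewrite -(derive_val (is_derive := dg)) -(derive_val (is_derive := df)).
apply: near_eq_derive.
have [e e0 eT] : exists2 e : R, 0 < e & forall s, `|t - s| < e -> (s%:E < T)%E.
  case: (T) tT => [r|_|//].
    rewrite lte_fin => tr; exists (r - t) => [|s]; first by rewrite subr_gt0.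
    by rewrite lte_fin ltr_norml => /andP[]; lra.
  by exists 1 => // s _; rewrite ltry.
near=> s.
(* This keeps [s] positive and below [T], where both trajectories agree; hence their derivatives at
   [t] coincide. *)
have : `|t - s| < Num.min e t.
  by near: s; apply: cvgr_dist_lt; [exact: cvg_id|rewrite lt_min e0].
rewrite lt_min => /andP[se st]; rewrite XX' ?eT//.
by move: st; rewrite ltr_norml => /andP[]; lra.
Unshelve. all: by end_near. Qed.

(** * Genericity and the equivalence *)

Lemma close_refl (R : realType) (n : nat) (U : set 'rV[R]_n) (e : R)
    (f : 'I_n -> 'rV[R]_n -> R) : 0 < e -> Defs.close U e f f.
Proof.
move=> e0 i; apply: (@le_lt_trans _ _ 0%E); last by rewrite lte_fin.
by apply: ge_ereal_sup => _ [x _ <-]; rewrite subrr normr0.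
Qed.

Theorem proposition3p4 (R : realType) (n : nat)
    (U : set 'rV[R]_n) (S : {set 'I_n})
    (U_open : open U) (U_nonempty : U !=set0)
    (S_nonempty : S != finset.set0) :
  generic U (fun f : 'I_n -> 'rV[R]_n -> R =>
    (forall i : 'I_n, structurally_identifiable U S f i)
    <-> fully_observable S).
Proof.
exists [set f | admissible U f /\ exists i x, U x /\ f i x != 0]; split.
- by move=> f [].
(* A field whose i-th component vanishes at [x] is at distance at least |f i x| from [f], so this
   radius excludes it. *)
- move=> f [af [i [x [Ux fx]]]]; exists `|f i x|; first by rewrite normr_gt0.
  move=> g ag /(_ i) fg; split=> //; exists i, x; split=> //.
  apply: contraTneq fg => gx; rewrite -leNgt; apply: ereal_sup_ubound.
  by exists x => //; rewrite gx subr0.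
- move=> f e af e0.
  have [[i [x [Ux fx]]]|f0] := pselect (exists i x, U x /\ f i x != 0).
    by exists f; [split=> //; exists i, x|exact: close_refl].
  have [x Ux] := U_nonempty.
  exists (fun _ _ => e / 2).
    split; first exact: cst_admissible.
    (* An element of [S] provides an index, so n > 0 and the constant field has a non-zero
       component. *)
    have /set0Pn[i _] := S_nonempty; exists i, x; split=> //.
    by rewrite gt_eqF// divr_gt0.
  move=> i; apply: (@le_lt_trans _ _ (e / 2)%:E); last first.
    by rewrite lte_fin; lra.
  apply: ge_ereal_sup => _ [y Uy <-].
  have -> : f i y = 0.
    by apply/eqP; apply: contra_notT f0 => fy; exists i, y.
  by rewrite sub0r normrN gtr0_norm// divr_gt0.
- move=> f [af [k [p [Up fp]]]]; split=> [idf|fo i]; last first.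
    exact: fully_observable_identifiable.
  apply/eqP; rewrite -finset.subTset; apply/fintype.subsetP => j _.
  apply: contraT => jS.
  by have := unobserved_not_identifiable U_open af jS Up fp (idf j).
Qed.
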